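(* Let $n \ge 2$ and let $\mathcal{S} \subset M_n(\mathbb{C})$ be an irreducible (multiplicative) semigroup of matrices such that each member of $\mathcal{S}$ is diagonally similar to a nonnegative matrix. Suppose that every member of $\mathcal{S}$ of rank at least $2$ is either indecomposable or $1$-decomposable. Then $\mathcal{S}$ is (simultaneously) diagonally similar to a semigroup of nonnegative matrices; that is, there exists an invertible diagonal matrix $D \in M_n(\mathbb{C})$ such that $D S D^{-1}$ has all entries in $\mathbb{R}_+$ for every $S \in \mathcal{S}$.
   Context: $\mathbb{R}_+$ is the set of nonnegative real numbers and $M_n(\mathbb{C})$ is the set of complex $n\times n$ matrices. A matrix is nonnegative if all its entries lie in $\mathbb{R}_+$. A matrix $A \in M_n(\mathbb{C})$ is diagonally similar to a matrix $B$ if $B = DAD^{-1}$ for some invertible diagonal matrix $D\in M_n(\mathbb{C})$. A semigroup of matrices is a set of matrices closed under matrix multiplication. A collection $\mathcal{C} \subseteq M_n(\mathbb{C})$ ($n\ge 2$) is irreducible if its members have no common invariant subspace other than $\{0\}$ and $\mathbb{C}^n$. The collection $\mathcal{C}$ is decomposable if there is a permutation matrix $P$ such that all matrices in $P\mathcal{C}P^{-1}$ have a common block upper-triangular form $\begin{pmatrix} * & * \\ 0 & * \end{pmatrix}$ with square diagonal blocks of sizes $k$ and $n-k$ for some $1\le k<n$; otherwise it is indecomposable. A single matrix $A$ is called indecomposable if the collection $\{A\}$ is indecomposable. For $n \ge 2$, an $n \times n$ matrix $A$ is $1$-decomposable if there is a permutation matrix $P$ such that $PAP^T = \begin{pmatrix}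 A_1 & B \\ 0 & A_2 \end{pmatrix}$, where each of $A_1$ and $A_2$ is either an indecomposable square matrix or a (possibly zero) $1\times 1$ block. *)

(* Defs.v *)
From HB Require Import structures.
From mathcomp Require Import all_boot all_order all_algebra perm.
From mathcomp Require Import complex.
From mathcomp Require Import classical_sets reals.
Set Implicit Arguments.
Unset Strict Implicit.
Unset Printing Implicit Defensive.
Import Order.TTheory GRing.Theory Num.Theory.
Local Open Scope ring_scope.
Local Open Scope complex_scope.

Section Definitions.
Variable R : realType.
Local Notation C := R[i].

(* On R[i], [0 <= z] means that z is real and nonnegative. *)
Definition nonneg_mx (n : nat) (A : 'M[C]_n) : Prop := forall i j, 0 <= A i j.

Definition inv_diag_mx (n : nat) (D : 'M[C]_n) : Prop :=
  is_diag_mx D /\ D \in unitmx.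

Definition diag_similar (n : nat) (A B : 'M[C]_n) : Prop :=
  exists2 D : 'M[C]_n, inv_diag_mx D & B = D *m A *m invmx D.

Definition mx_semigroup (n : nat) (S : set 'M[C]_n) : Prop :=
  forall A B, S A -> S B -> S (A *m B).

(* Matrices act on column vectors. *)
Definition invariant_subspace (n : nat) (S : set 'M[C]_n)
    (W : {vspace 'cV[C]_n}) : Prop :=
  forall A, S A -> forall v, v \in W -> A *m v \in W.

Definition irreducible (n : nat) (S : set 'M[C]_n) : Prop :=
  forall W : {vspace 'cV[C]_n},
    invariant_subspace S W -> W = 0%VS \/ W = fullv.

Definition decomposable (n : nat) (S : set 'M[C]_n) : Prop :=
  exists (k m : nat) (kmn : (k + m)%N = n) (s : 'S_n),
    [/\ (0 < k)%N, (0 < m)%N &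
      forall A, S A ->
        exists (A1 : 'M[C]_k) (B : 'M[C]_(k, m)) (A2 : 'M[C]_m),
          perm_mx s *m A *m invmx (perm_mx s)
            = castmx (kmn, kmn) (block_mx A1 B 0 A2)].

Definition indecomposable (n : nat) (S : set 'M[C]_n) : Prop :=
  ~ decomposable S.

Definition indecomposable_mx (n : nat) (A : 'M[C]_n) : Prop :=
  indecomposable [set A]%classic.

(* The alternative [k = 1] is already covered by [indecomposable_mx], which
   holds vacuously in size 1. *)
Definition one_decomposable (n : nat) (A : 'M[C]_n) : Prop :=
  exists (k m : nat) (kmn : (k + m)%N = n) (s : 'S_n)
         (A1 : 'M[C]_k) (B : 'M[C]_(k, m)) (A2 : 'M[C]_m),
    [/\ (0 < k)%N, (0 < m)%N,
        perm_mx s *m A *m (perm_mx s)^T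
          = castmx (kmn, kmn) (block_mx A1 B 0 A2),
        k = 1%N \/ indecomposable_mx A1 &
        m = 1%N \/ indecomposable_mx A2].

End Definitions.

(* Main.v *)
Require Import Defs.
From mathcomp Require Import all_boot all_order all_algebra perm.
From mathcomp Require Import complex boolp classical_sets reals.
From mathcomp Require Import ring lra.

(** Let [T] be the closed convex cone of all matrices at which every complex
linear functional is nonnegative that is nonnegative on [S] and the identity
([bidual_cone]). A matrix that is diagonally similar to a nonnegative one has a
nonnegative diagonal; since [S] is a semigroup, [T] is a multiplicative monoid
all of whose members have a nonnegative diagonal. The gain over [S] is that [T]
contains resolvents, their limits and, as it turns out, matrices of rank one.

Perron's theorem holds inside [T] ([cone_eigen]). Given [X] in [T], let [r] be
the infimum of the real [t] such that [s - X] is invertible with inverse in [T]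
for every [s >= t]. By Neumann series the property holds for large [t] and
extends to the left of any [t] where it holds; as [T] is closed, [r - X] must be
singular, and the leading coefficient of the resolvent at [r] is a nonzero [L] in [T] with
[X L = L X = r L]. The infimum exists because the property fails at [0]: the
product of [X] and [(0 - X)^-1] is [- 1], whose trace is negative.

Take [L] in [T] of least nonzero rank and factor it as [L = C F] with [C]
of full column rank and [F] of full row rank ([exists_rank1]). For [X] in [S]
the small matrix [F X C] has a Perron eigenmatrix [Z]; as [C Z F] lies in [T],
minimality makes [Z] invertible, hence [F X C] is scalar. Irreducibility allows
this for all [X] only if the rank is one. So [T] contains some [u v], with [u]
a column and [v] a row. The diagonal of [X u v Y] being nonnegative,
[(X u)_i (v Y)_i >= 0] for all [X, Y]: the phase of the [i]-th coordinate is
the same for all the columns [X u], and opposite for all the rows [v Y].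
A diagonal similarity thus makes all these vectors nonnegative. After it, [S]
preserves two families of nonnegative vectors that separate points
([positive_frames]).

Let now [A] be in [S]. If its rank is at most one, the two families force it to
be nonnegative ([rank1_nneg]). Otherwise [A = d^-1 N d] for some diagonal [d]
and nonnegative [N], and by hypothesis the zero pattern of [A] is either
irreducible, or block triangular with irreducible diagonal blocks. If the
off-diagonal block is zero the diagonal blocks are treated one by one. In the
other cases the pattern is so connected that a nonnegative eigenmatrix [M] of
[N] has rank one, [M = x y], and that every index lies in the support of [x] or
of [y] ([nneg_eigenmatrix_rank1]). The Perron eigenmatrix [L = d^-1 M d] of [A]
lies in the bidual cone of the powers of [A], so it maps both families to
nonnegative vectors and is nonnegative by the rank-one case. As [L] and [M] are both
nonnegative, the entries of [d] have pairwise positive ratios, whence [A] itself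
is nonnegative ([nneg_of_local]). *)

Set Implicit Arguments.
Unset Strict Implicit.
Unset Printing Implicit Defensive.
Import Order.TTheory GRing.Theory Num.Theory.
(* [Num.Theory] exports other constants under these two names. *)
Local Notation Re := complex.Re.
Local Notation Im := complex.Im.
Local Open Scope ring_scope.
Local Open Scope complex_scope.

(** * Limits of nonnegative complex numbers *)

(** The order of [R[i]] is partial, so the closedness of the nonnegative
half-line has to be checked on the imaginary part as well as on the real one. *)
Lemma ge0_of_approx (R : realType) (z : R[i]) :
  (forall e : R, 0 < e -> exists2 a, 0 <= a & `|z - a| <= e%:C) -> 0 <= z.
Proof.
move=> az; rewrite lecE /=.
have Reb (e : R) : 0 < e -> `|Im z| <= e /\ - e <= Re z.
  move=> /az[a a0 zae]; move: a0; rewrite lecE /= => /andP[/eqP Ia Ra].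
  have Ib : `|Im z| <= e.
    rewrite -lecR; apply: le_trans zae; have := normc_ge_Re ((z - a) * 'i).
    rewrite ReiNIm normrN normrM [`|'i%C|]normc_def /= expr0n expr1n add0r.
    rewrite sqrtr1 mulr1.
    by rewrite raddfB /= Ia subr0.
  split=> //; have : `|Re (z - a)| <= e.
    by rewrite -lecR (le_trans _ zae)// normc_ge_Re.
  by rewrite raddfB /= ler_norml => /andP[]; lra.
apply/andP; split.
  rewrite -normr_eq0 eq_le normr_ge0 andbT leNgt; apply/negP => Ipos.
  by have [] := Reb (`|Im z| / 2) ltac:(lra); lra.
rewrite leNgt; apply/negP => Rneg.
by have [_] := Reb (- Re z / 2) ltac:(lra); lra.
Qed.

Lemma horner_bound (R : realType) (q : {poly R[i]}) (b : R) :
  exists2 M : R, 0 <= M & forall x, `|x| <= b%:C -> `|q.[x]| <= M%:C.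
Proof.
elim/poly_ind: q => [|q c [M M0 IH]].
  by exists 0 => // x _; rewrite horner0 normr0.
have [d cE] : exists d : R, `|c| = d%:C.
  by exists (Re `|c|); rewrite RRe_real ?normr_real.
have d0 : 0 <= d by rewrite -lecR -cE; exact: normr_ge0.
exists (M * `|b| + d) => [|x xb]; first by rewrite addr_ge0 ?mulr_ge0.
rewrite hornerMXaddC (le_trans (ler_normD _ _))// rmorphD rmorphM /=.
rewrite -cE lerD2r normrM ler_pM// ?IH//.
by rewrite (le_trans xb)// lecR ler_norm.
Qed.

(** Limits of resolvents are reached through this form of continuity: clearing
the denominators turns their entries into polynomials in [t]. *)
Lemma horner_ge0_right (R : realType) (p : {poly R[i]}) (r : R) :
  (forall t : R, r < t -> 0 <= p.[t%:C]) -> 0 <= p.[r%:C].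
Proof.
move=> p0; apply: ge0_of_approx => e e0.
have /factor_theorem[q pE] : root (p - p.[r%:C]%:P) r%:C.
  by rewrite rootE !hornerE subrr.
have [M M0 qM] := horner_bound q (`|r| + 1).
(* A step of at most 1 keeps [r + h] in the ball where the cofactor [q] is
bounded by [M]; a step of at most [e / (M + 1)] makes the increment small. *)
pose h := Num.min 1 (e / (M + 1)).
have h0 : 0 < h by rewrite lt_min ltr01 divr_gt0// ltr_wpDl.
exists p.[(r + h)%:C]; first by rewrite p0// ltrDl.
have -> : p.[r%:C] - p.[(r + h)%:C] = - (q.[(r + h)%:C] * h%:C).
  have /(congr1 (fun s => s.[(r + h)%:C])) := pE.
  rewrite !hornerE => /eqP; rewrite subr_eq => /eqP ->.
  by rewrite (_ : (r + h)%:C = r%:C + h%:C) ?rmorphD//; ring.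
have hC0 : 0 <= h%:C by rewrite lecR ltW.
rewrite normrN normrM (ger0_norm hC0).
have qh : `|q.[(r + h)%:C]| <= M%:C.
  apply: qM; rewrite normc_def /= expr0n addr0 sqrtr_sqr lecR.
  rewrite (le_trans (ler_normD _ _))// lerD2l (ger0_norm (ltW h0)).
  by rewrite ge_min lexx.
apply: (@le_trans _ _ (M * h)%:C); first by rewrite rmorphM /= ler_wpM2r.
rewrite lecR (@le_trans _ _ (M * (e / (M + 1))))//.
  by rewrite ler_wpM2l// ge_min lexx orbT.
rewrite mulrCA -ler_pdivlMl// mulVf ?gt_eqF// ler_pdivrMr ?ltr_wpDl// mul1r.
by rewrite lerDl.
Qed.

(** * The bidual cone of a set of matrices *)

Definition mx_monoid (R : realType) n (G : set 'M[R[i]]_n) : Prop :=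
  G 1%:M /\ mx_semigroup G.

(** A closed convex cone around [G], cut out by the linear functionals
[X |-> tr (L X)] that take nonnegative real values on [G]. In this form
closedness needs no topology, and a property that linear functionals can test
passes from [G] to the whole cone in one step. *)
Definition bidual_cone (R : realType) n (G : set 'M[R[i]]_n) : set 'M[R[i]]_n :=
  fun X => forall L : 'M[R[i]]_n,
    (forall A, G A -> 0 <= \tr (L *m A)) -> 0 <= \tr (L *m X).

Lemma bidual_cone_gen (R : realType) n (G : set 'M[R[i]]_n) A :
  G A -> bidual_cone G A.
Proof. by move=> GA L; apply. Qed.

Lemma bidual_coneZ (R : realType) n (G : set 'M[R[i]]_n) (c : R[i]) X :
  0 <= c -> bidual_cone G X -> bidual_cone G (c *: X).
Proof. by move=> c0 GX L LG; rewrite -scalemxAr mxtraceZ mulr_ge0 ?GX. Qed.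

(** The functional [X |-> tr (L P X Q)] is again of the form
[X |-> tr (L' X)], with [L' = Q L P]. *)
Lemma bidual_cone_trans (R : realType) n m (G : set 'M[R[i]]_n)
    (H : set 'M[R[i]]_m) (P : 'M_(m, n)) (Q : 'M_(n, m)) X :
  (forall A, G A -> bidual_cone H (P *m A *m Q)) ->
  bidual_cone G X -> bidual_cone H (P *m X *m Q).
Proof.
have trE L A : \tr (L *m (P *m A *m Q)) = \tr (Q *m L *m P *m A).
  by rewrite !mulmxA mxtrace_mulC !mulmxA.
move=> PGQ GX L LH; rewrite trE; apply: GX => A GA.
by rewrite -trE; apply: PGQ.
Qed.

Lemma bidual_cone_entry (R : realType) n p q (G : set 'M[R[i]]_n)
    (P : 'M_(p, n)) (Q : 'M_(n, q)) X i j :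
  (forall A, G A -> 0 <= (P *m A *m Q) i j) ->
  bidual_cone G X -> 0 <= (P *m X *m Q) i j.
Proof.
have entryE A : (P *m A *m Q) i j = \tr (col j Q *m row i P *m A).
  rewrite -[in RHS]mulmxA mxtrace_mulC [RHS]big_ord1 -row_mul [LHS]mxE [RHS]mxE.
  by apply: eq_bigr => k _; rewrite [row _ _ _ _]mxE [col _ _ _ _]mxE.
by move=> PGQ; rewrite entryE; apply=> A /PGQ; rewrite entryE.
Qed.

(** Multiplication by a fixed element preserves positivity of functionals on
[G]; letting first [X] and then [Y] run through the cone gives the product. *)
Lemma bidual_coneM (R : realType) n (G : set 'M[R[i]]_n) X Y :
  mx_semigroup G -> bidual_cone G X -> bidual_cone G Y -> bidual_cone G (X *m Y).
Proof.
move=> Gmul GX GY; rewrite -[_ *m Y]mulmx1.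
apply: bidual_cone_trans GY => A GA; rewrite mulmx1.
rewrite -[X]mul1mx; apply: bidual_cone_trans GX => B GB.
by rewrite mul1mx; apply/bidual_cone_gen/Gmul.
Qed.

Lemma bidual_coneX (R : realType) n (G : set 'M[R[i]]_n.+1) X k :
  mx_monoid G -> bidual_cone G X -> bidual_cone G (X ^+ k).
Proof.
move=> [G1 Gmul] GX; elim: k => [|k IH]; first exact: bidual_cone_gen.
by rewrite exprS; apply: bidual_coneM.
Qed.

(** * Neumann series *)

Lemma exp_half_le (R : realType) (c e : R) :
  0 <= c -> 0 < e -> exists k, c * 2^-1 ^+ k <= e.
Proof.
move=> c0 e0; have ce0 : 0 <= c / e by rewrite divr_ge0// ltW.
exists (Num.bound (c / e)); rewrite exprVn ler_pdivrMr ?exprn_gt0//.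
rewrite mulrC -ler_pdivrMr// (le_trans (ltW (archi_boundP ce0)))//.
by rewrite -natrX ler_nat ltnW// ltn_expl.
Qed.

(** The bound makes every absolute row sum at most one half. *)
Definition half_contraction (R : realType) n (Z : 'M[R[i]]_n) : Prop :=
  forall i j, `|Z i j| <= (2 * n%:R)^-1.

Lemma half_contraction_exp (R : realType) n (Z : 'M[R[i]]_n.+1) k i j :
  half_contraction Z -> `|(Z ^+ k) i j| <= 2^-1 ^+ k.
Proof.
move=> hZ; elim: k i j => [|k IH] i j.
  by rewrite !expr0 mxE; case: (i == j); rewrite ?normr1 ?normr0 ?ler01.
rewrite !exprS mxE (le_trans (ler_norm_sum _ _ _))//.
have -> : 2^-1 * 2^-1 ^+ k
    = \sum_(l < n.+1) (2 * n.+1%:R)^-1 * 2^-1 ^+ k :> R[i].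
  rewrite sumr_const card_ord -[RHS]mulr_natl mulrA; congr (_ * _).
  by rewrite invfM mulrCA divff ?mulr1// pnatr_eq0.
by apply: ler_sum => l _; rewrite normrM ler_pM.
Qed.

Lemma half_contraction_trace (R : realType) n (L Z : 'M[R[i]]_n.+1) (e : R) :
  half_contraction Z -> 0 < e -> exists k, `|\tr (L *m Z ^+ k)| <= e%:C.
Proof.
move=> hZ e0; pose c := \sum_i \sum_j `|L i j|.
have c0 : 0 <= c by do 2!apply: sumr_ge0 => ? _.
have [d cE] : exists d : R, c = d%:C by exists (Re c); rewrite RRe_real// ger0_real.
have d0 : 0 <= d by rewrite -lecR -cE.
have [k kP] := exp_half_le d0 e0; exists k.
apply: (@le_trans _ _ (c * 2^-1 ^+ k)).
  rewrite /mxtrace (le_trans (ler_norm_sum _ _ _))// mulr_suml.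
  apply: ler_sum => i _; rewrite mxE (le_trans (ler_norm_sum _ _ _))//.
  rewrite mulr_suml; apply: ler_sum => j _.
  by rewrite normrM ler_wpM2l// half_contraction_exp.
move: kP; rewrite -lecR cE => /(le_trans _); apply.
by rewrite rmorphM rmorphXn fmorphV rmorph_nat.
Qed.

Lemma half_contraction_unit (R : realType) n (Z : 'M[R[i]]_n.+1) :
  half_contraction Z -> 1%:M - Z \in unitmx.
Proof.
move=> hZ; rewrite unitmxE unitfE; apply/det0P => -[v v0].
rewrite mulmxBr mulmx1 => /eqP; rewrite subr_eq0 => /eqP vZ.
have vZk k : v = v *m Z ^+ k.
  by elim: k => [|k IH]; rewrite ?expr0 ?mulmx1// exprS -mulmxE mulmxA -vZ.
move/negP: v0; apply; apply/eqP/rowP => j; rewrite [RHS]mxE.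
apply/eqP; rewrite -normr_le0 -oppr_ge0; apply: ge0_of_approx => e e0.
have [k kP] := half_contraction_trace (delta_mx j 0 *m v) hZ e0.
exists 0 => //; rewrite subr0 normrN normr_id; apply: le_trans kP.
by rewrite -mulmxA -vZk mxtrace_mulC -colE /mxtrace big_ord1 mxE.
Qed.

(** The partial sums of the Neumann series lie in the cone, and the remainder
[Z ^+ k (1 - Z)^-1] tends to zero. *)
Lemma half_contraction_inv (R : realType) n (G : set 'M[R[i]]_n.+1) Z :
  mx_monoid G -> bidual_cone G Z -> half_contraction Z ->
  1%:M - Z \in unitmx -> bidual_cone G (invmx (1%:M - Z)).
Proof.
move=> Gmon GZ hZ uZ L LG; set W := invmx _.
apply: ge0_of_approx => e e0.
have [k kP] := half_contraction_trace (W *m L) hZ e0.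
exists (\sum_(j < k) \tr (L *m Z ^+ j)).
  by apply: sumr_ge0 => j _; exact: (bidual_coneX j Gmon GZ LG).
suff -> : \tr (L *m W) - \sum_(j < k) \tr (L *m Z ^+ j)
   = \tr (W *m L *m Z ^+ k) by [].
have WE : W = \sum_(j < k) Z ^+ j + Z ^+ k *m W.
  rewrite -[LHS]mul1mx -[1%:M](subrK (Z ^+ k)) mulmxDl; congr (_ + _).
  have -> : 1%:M - Z ^+ k = (\sum_(j < k) Z ^+ j) *m (1%:M - Z).
    have /(congr1 -%R) := subrX1 Z k; rewrite opprB -mulNr opprB => ->.
    apply: commr_sum => j _; apply/commr_sym/commrB; first exact: commr1.
    exact/commr_sym/commrX/commr_refl.
  by rewrite mulmxK.
rewrite [in LHS]WE mulmxDr raddfD /= mulmx_sumr raddf_sum /= addrAC subrr add0r.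
by rewrite !mulmxA mxtrace_mulC mulmxA.
Qed.

Lemma half_contraction_small (R : realType) n (X : 'M[R[i]]_n.+1) :
  exists2 e0 : R, 0 < e0 &
    forall e : R, 0 <= e -> e <= e0 -> half_contraction (e%:C *: X).
Proof.
pose c := \sum_i \sum_j `|X i j|.
have c0 : 0 <= c by do 2!apply: sumr_ge0 => ? _.
have [d cE] : exists d : R, c = d%:C.
  by exists (Re c); rewrite RRe_real// ger0_real.
have d0 : 0 <= d by rewrite -lecR -cE.
have Xd i j : `|X i j| <= (d + 1)%:C.
  apply: (@le_trans _ _ c); last by rewrite cE lecR lerDl.
  rewrite /c (bigD1 i)//= (bigD1 j)//= -addrA lerDl.
  by rewrite addr_ge0 ?sumr_ge0// => k _; rewrite sumr_ge0.
have n0 : 0 < 2 * n.+1%:R :> R by rewrite mulr_gt0// ltr0n.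
have d1 : 0 < d + 1 by rewrite ltr_wpDl.
exists ((2 * n.+1%:R)^-1 / (d + 1)) => [|e e_ge0 ele i j].
  by rewrite divr_gt0// invr_gt0.
have eC0 : 0 <= e%:C by rewrite lecR.
rewrite mxE normrM (ger0_norm eC0).
apply: (@le_trans _ _ (e%:C * (d + 1)%:C)); first by rewrite ler_wpM2l.
have -> : (2 * n.+1%:R)^-1 = ((2 * n.+1%:R)^-1)%:C :> R[i].
  by rewrite fmorphV rmorphM !rmorph_nat.
by rewrite -rmorphM lecR -ler_pdivlMr.
Qed.

(** * Resolvents in the cone *)

Definition resolvent_in (R : realType) n (G : set 'M[R[i]]_n.+1) X (t : R) :=
  t%:C%:M - X \in unitmx /\ bidual_cone G (invmx (t%:C%:M - X)).

(** Write [t - X = t (1 - X / t)] and use the Neumann series in [X / t]. *)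
Lemma resolvent_large (R : realType) n (G : set 'M[R[i]]_n.+1) X :
  mx_monoid G -> bidual_cone G X ->
  exists t0 : R, forall t, t0 <= t -> resolvent_in G X t.
Proof.
move=> Gmon GX; have [e e0 eX] := half_contraction_small X.
exists e^-1 => t et; have t0 : 0 < t by rewrite (lt_le_trans _ et) ?invr_gt0.
have tC0 : t%:C != 0 by rewrite -[0]/(0%:C) (inj_eq (@complexI _)) gt_eqF.
have tX : half_contraction ((t^-1)%:C *: X).
  by apply: eX; rewrite ?invr_ge0 ?(ltW t0)// invf_ple.
have tV0 : 0 <= (t^-1)%:C by rewrite lecR invr_ge0 ltW.
have uX := half_contraction_unit tX.
rewrite /resolvent_in.
have -> : t%:C%:M - X = t%:C *: (1%:M - (t^-1)%:C *: X).
  by rewrite scalerBr scalemx1 scalerA -rmorphM mulfV ?gt_eqF// scale1r.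
split; first by rewrite unitmxZ// unitfE.
rewrite invmxZ ?unitmxZ ?unitfE// -fmorphV.
apply: bidual_coneZ => //; apply: half_contraction_inv => //.
exact: bidual_coneZ.
Qed.

(** Lowering [t] is harmless for positivity: with [W] the resolvent at [r], one
has [t - X = (r - X) (1 - (r - t) W)], and the Neumann series in [(r - t) W]
has nonnegative coefficients because [t <= r]. *)
Lemma resolvent_open (R : realType) n (G : set 'M[R[i]]_n.+1) X r :
  mx_monoid G -> resolvent_in G X r ->
  exists2 e0 : R, 0 < e0 &
    forall t, r - e0 <= t -> t <= r -> resolvent_in G X t.
Proof.
move=> Gmon [uW GW]; set W := invmx _ in GW.
have [e e0 eW] := half_contraction_small W.
exists e; first exact: e0.
move=> t rt tr.
have tW : half_contraction ((r - t)%:C *: W) by apply: eW; lra.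
have rt0 : 0 <= (r - t)%:C by rewrite lecR subr_ge0.
have uX := half_contraction_unit tW.
have tE : t%:C%:M - X = (r%:C%:M - X) *m (1%:M - (r - t)%:C *: W).
  rewrite mulmxBr mulmx1 -scalemxAr mulmxV// scalemx1 rmorphB raddfB /=.
  by rewrite opprB [RHS]addrC addrA addrNK.
have uT : t%:C%:M - X \in unitmx by rewrite tE unitmx_mul uW uX.
split; first exact: uT.
have -> : invmx (t%:C%:M - X) = invmx (1%:M - (r - t)%:C *: W) *m W.
  apply: (can_inj (mulKmx uT)); rewrite mulmxV// tE.
  by rewrite mulmxA mulmxK// mulmxV.
apply: bidual_coneM => //; first by case: Gmon.
by apply: half_contraction_inv => //; apply: bidual_coneZ.
Qed.

(** The number [r] is the infimum of the [t] such that all resolvents to the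
right of [t] exist and lie in the cone. These [t] are bounded below by [0],
since otherwise the cone would contain [X (0 - X)^-1 = - 1], which has negative
trace. Openness to the left excludes [r] itself. *)
Lemma resolvent_edge (R : realType) n (G : set 'M[R[i]]_n.+1) X :
  mx_monoid G -> (forall A, G A -> 0 <= \tr A) -> bidual_cone G X ->
  exists r : R, (forall t, r < t -> resolvent_in G X t) /\ ~ resolvent_in G X r.
Proof.
move=> Gmon Gtr GX.
pose E : set R := [set t | forall s, t <= s -> resolvent_in G X s]%classic.
have E0 : (E !=set0)%classic.
  by have [t0 t0P] := resolvent_large Gmon GX; exists t0.
have Elb : lbound E 0.
  move=> t Et; rewrite leNgt; apply/negP => t0.
  have [] := Et 0 (ltW t0); rewrite (_ : 0%:C%:M - X = - X); last first.
    by rewrite raddf0 add0r.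
  move=> uX GW; have := bidual_coneM Gmon.2 GX GW.
  rewrite -[X in X *m _]opprK mulNmx mulmxV// => /(_ 1%:M).
  rewrite mulmxN mul1mx raddfN /= mxtrace1 oppr_ge0 => /(_ _)/wrap[].
    by move=> A /Gtr; rewrite mul1mx.
  by rewrite lern0.
have rE t : inf E < t -> resolvent_in G X t.
  by move=> /(inf_lt E0)[s Es st]; apply: Es; apply: ltW.
exists (inf E); split=> // Gr.
have [e e0 eP] := resolvent_open Gmon Gr.
have : inf E <= inf E - e.
  apply: ge_inf; first by exists 0.
  move=> s rs; have [sr|] := leP s (inf E); last exact: rE.
  exact: eP.
lra.
Qed.

(** * A Perron eigenmatrix in the cone *)

(** The quotient of [p.[t] - p] by [t - 'X], written out so that its dependence
on [t] is visibly polynomial. *)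
Definition diff_quot (R : realType) (p : {poly R[i]}) (t : R[i]) : {poly R[i]} :=
  \sum_(k < size p) p`_k *: \sum_(i < k) t ^+ (k.-1 - i) *: 'X^i.

Lemma diff_quotE (R : realType) (p : {poly R[i]}) t :
  (t%:P - 'X) * diff_quot p t = p.[t]%:P - p.
Proof.
rewrite mulr_sumr -[X in _ = _ - X]coefK poly_def horner_coef rmorph_sum /= -sumrB.
apply: eq_bigr => k _; rewrite -scalerAr polyCM mul_polyC -scalerBr.
congr (_ *: _); rewrite polyC_exp subrXX; congr (_ * _).
by apply: eq_bigr => i _; rewrite -mul_polyC polyC_exp.
Qed.

(** Evaluating the difference quotient of the minimal polynomial [mu] at [X]
gives [mu.[t] (t - X)^-1] when [t] is not an eigenvalue, and a matrix of
eigenvectors when it is; it never vanishes, because its degree is smaller than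
that of [mu]. *)
Lemma horner_mx_diff_quot (R : realType) n (X : 'M[R[i]]_n.+1) t :
  let h := horner_mx X (diff_quot (mxminpoly X) t) in
  [/\ (t%:M - X) *m h = (mxminpoly X).[t]%:M, h *m X = X *m h & h != 0].
Proof.
set mu := mxminpoly X; set q := diff_quot mu t; move=> h.
have qE := diff_quotE mu t; split.
- have := congr1 (horner_mx X) qE.
  rewrite rmorphM (rmorphB _ t%:P) (rmorphB _ mu.[t]%:P) /= !horner_mx_C.
  by rewrite horner_mx_X /mu mx_root_minpoly subr0.
- by have := congr1 (horner_mx X) (mulrC q 'X); rewrite !rmorphM /= horner_mx_X.
have s_mu : (1 < size mu)%N by rewrite size_mxminpoly ltnS mxminpoly_nonconstant.
have s_r : size (mu.[t]%:P - mu) = size mu.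
  by rewrite addrC size_polyDl size_polyN// (leq_ltn_trans (size_polyC_leq1 _)).
have q0 : q != 0.
  by apply: contraTneq s_mu => q0; rewrite -s_r -qE -/q q0 mulr0 size_poly0.
rewrite -[_ == 0]dvd_mxminpoly; apply/negP => /(dvdp_leq q0).
rewrite leqNgt -/mu -s_r -qE -/q -opprB mulNr size_polyN mulrC size_Mmonic//.
  by rewrite size_XsubC addn2 /= ltnSn.
exact: monicXsubC.
Qed.

Lemma trace_diff_quot (R : realType) n (X L : 'M[R[i]]_n.+1) (p : {poly R[i]}) :
  exists q : {poly R[i]},
    forall t, q.[t] = \tr (L *m horner_mx X (diff_quot p t)).
Proof.
exists (\sum_(k < size p) p`_k *:
   \sum_(i < k) \tr (L *m X ^+ i) *: 'X^(k.-1 - i)) => t.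
rewrite horner_sum rmorph_sum mulmx_sumr raddf_sum /=; apply: eq_bigr => k _.
rewrite hornerZ linearZ /= -scalemxAr mxtraceZ; congr (_ * _).
rewrite horner_sum rmorph_sum mulmx_sumr raddf_sum /=; apply: eq_bigr => i _.
rewrite hornerZ hornerXn linearZ /= -scalemxAr mxtraceZ rmorphXn /= horner_mx_X.
by rewrite mulrC.
Qed.

(** Write the minimal polynomial as [g ('X - r)^m] with [g.[r] != 0], and let
[h t] be the value at [X] of its difference quotient. For [t > r] the matrix
[conj g.[t] *: h t] is the resolvent at [t] times the positive number
[|g.[t]|^2 (t - r)^m], hence lies in the cone; as it depends polynomially on the
real number [t], so does its value at [r], which is nonzero. The scalar [c] is
zero exactly if [r] is an eigenvalue. *)
Lemma resolvent_limit (R : realType) n (G : set 'M[R[i]]_n.+1) X (r : R) :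
  (forall t, r < t -> resolvent_in G X t) ->
  exists L : 'M[R[i]]_n.+1, [/\ bidual_cone G L, L != 0, L *m X = X *m L &
    exists2 c : R[i], 0 <= c & (r%:C%:M - X) *m L = c%:M].
Proof.
move=> Gr; set mu := mxminpoly X.
have mu0 : mu != 0 by rewrite monic_neq0// mxminpoly_monic.
have [m [g [g0 muE]]] : exists m (g : {poly R[i]}),
    ~~ root g r%:C /\ mu = g * ('X - r%:C%:P) ^+ m.
  by have [m [g]] := multiplicity_XsubC mu r%:C; rewrite mu0; exists m, g.
pose h t := horner_mx X (diff_quot mu t).
have [hE hX h0] := horner_mx_diff_quot X r%:C.
have gg0 (z : R[i]) : 0 <= conjc z * z by rewrite mulrC -sqr_normc exprn_ge0.
exists (conjc g.[r%:C] *: h r%:C); split.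
- move=> L LG; have [q qE] := trace_diff_quot X L mu.
  rewrite -scalemxAr mxtraceZ -qE.
  have gJ (t : R) : (map_poly conjc g).[t%:C] = conjc g.[t%:C].
    by rewrite -{1}[t%:C]conjc_real horner_map.
  rewrite -gJ -hornerM; apply: horner_ge0_right => t rt.
  have [ut Gt] := Gr t rt; rewrite hornerM gJ qE.
  have [tE _ _] := horner_mx_diff_quot X t%:C.
  have -> : horner_mx X (diff_quot mu t%:C) = mu.[t%:C] *: invmx (t%:C%:M - X).
    by apply: (can_inj (mulKmx ut)); rewrite tE -scalemxAr mulmxV// scalemx1.
  rewrite -scalemxAr mxtraceZ muE hornerM horner_exp hornerXsubC.
  rewrite !mulrA mulr_ge0//; last exact: Gt.
  rewrite mulr_ge0 ?gg0// exprn_ge0// -rmorphB lecR subr_ge0; exact: ltW.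
- rewrite scaler_eq0 negb_or h0 andbT conjc_eq0; exact: g0.
- by rewrite -scalemxAl hX scalemxAr.
exists (conjc g.[r%:C] * mu.[r%:C]); last by rewrite -scalemxAr hE scale_scalar_mx.
rewrite muE hornerM horner_exp hornerXsubC subrr mulrA mulr_ge0 ?gg0//.
by rewrite exprn_ge0.
Qed.

(** An analogue of Perron's theorem for the cone [bidual_cone G]. At the edge [r]
of the resolvent set the limit [L] satisfies [(r - X) L = c] with [c >= 0]; a
positive [c] would make [L / c] a resolvent in the cone at [r]. *)
Lemma cone_eigen (R : realType) n (G : set 'M[R[i]]_n.+1) X :
  mx_monoid G -> (forall A, G A -> 0 <= \tr A) -> bidual_cone G X ->
  exists (r : R) (L : 'M[R[i]]_n.+1),
    [/\ bidual_cone G L, L != 0, X *m L = r%:C *: L & L *m X = r%:C *: L].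
Proof.
move=> Gmon Gtr GX; have [r [Gr nGr]] := resolvent_edge Gmon Gtr GX.
have [L [GL L0 LX [c c0 rL]]] := resolvent_limit Gr.
exists r, L; suff c_eq0 : c = 0.
  have XL : X *m L = r%:C *: L.
    apply/eqP; rewrite eq_sym -subr_eq0 -mul_scalar_mx -mulmxBl rL c_eq0.
    by rewrite raddf0.
  by rewrite LX.
apply: contra_notP nGr => /eqP cn0.
have rL1 : (r%:C%:M - X) *m (c^-1 *: L) = 1%:M.
  by rewrite -scalemxAr rL scale_scalar_mx mulVf.
have [uX _] := mulmx1_unit rL1; split=> //.
rewrite -[invmx _]mulmx1 -rL1 mulKmx//.
by apply: bidual_coneZ => //; rewrite invr_ge0.
Qed.

(** * Rank-one matrices in the cone of an irreducible semigroup *)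

Definition with_one (R : realType) n (S : set 'M[R[i]]_n) : set 'M[R[i]]_n :=
  fun A => A = 1%:M \/ S A.

Lemma with_one_monoid (R : realType) n (S : set 'M[R[i]]_n) :
  mx_semigroup S -> mx_monoid (with_one S).
Proof.
move=> Smul; split; first by left.
by move=> A B [->|SA] [->|SB]; rewrite ?mul1mx ?mulmx1;
  [left|right|right|right; apply: Smul].
Qed.

(** The vectors [A x], for [A] in the monoid, span a nonzero invariant subspace.
This span is realised as that of a finite list of maximal dimension. *)
Lemma irreducible_transitive (R : realType) n (S : set 'M[R[i]]_n)
    (x : 'cV[R[i]]_n) (y : 'rV[R[i]]_n) :
  mx_semigroup S -> irreducible S -> x != 0 -> y != 0 ->
  exists2 A, with_one S A & (y *m A *m x) 0 0 != 0.
Proof.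
move=> Smul Sirr x0 y0; have [_ S1mul] := with_one_monoid Smul.
pose span (s : seq 'M[R[i]]_n) := (<<[seq A *m x | A <- s]>>)%VS.
pose P d := `[< exists2 s, {in s, forall A, with_one S A} & \dim (span s) = d >].
have exP : exists d, P d.
  by exists 0; apply/asboolP; exists [::] => //; rewrite /span /= span_nil dimv0.
have Pmax d : P d -> (d <= \dim {: 'cV[R[i]]_n})%N.
  by move=> /asboolP[s _ <-]; apply/dimvS/subvf.
have [_ /asboolP[s sS <-] smax] := ex_maxnP exP Pmax; set W := span s.
have Wx A : with_one S A -> A *m x \in W.
  move=> SA; have /dimv_leqif_sup[dimle dimE] : (W <= span (A :: s))%VS.
    by rewrite /span /= span_cons addvSr.
  have /smax : P (\dim (span (A :: s))).
    by apply/asboolP; exists (A :: s) => // B; rewrite inE => /predU1P[->|/sS].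
  move=> dimge; have : (span (A :: s) <= W)%VS.
    by rewrite -dimE eqn_leq dimle dimge.
  by move=> /subvP; apply; apply/memv_span/mem_head.
have Winv : invariant_subspace S W.
  move=> A SA v Wv; suff /subvP/(_ v Wv) : (W <= linfun (mulmx A) @^-1: W)%VS.
    by rewrite -memv_preim lfunE.
  apply/span_subvP => _ /mapP[B sB ->].
  rewrite -memv_preim lfunE /= mulmxA; apply: Wx; apply: S1mul; first by right.
  exact: sS.
have xW : x \in W by rewrite -[x]mul1mx; apply: Wx; left.
have WT : W = fullv.
  by case: (Sirr W Winv) => // W0; move: xW x0; rewrite W0 memv0 => ->.
apply: contrapT => noA; move/negP: y0; apply; apply/eqP/rowP => j.
have : (W <= lker (linfun (mulmx y)))%VS.
  apply/span_subvP => _ /mapP[B sB ->].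
  rewrite memv_ker lfunE /= mulmxA; apply/eqP/matrixP => a b.
  rewrite !ord1 [RHS]mxE; apply: contrapT => /eqP yBx.
  by apply: noA; exists B => //; apply: sS.
rewrite WT => /subvP/(_ (delta_mx j 0) (memvf _)).
rewrite memv_ker lfunE /= -colE => /eqP/matrixP/(_ 0 0).
by rewrite !mxE.
Qed.

(** Let [L = C F] be a full rank factorization of an element of least nonzero
rank. Minimality forces the Perron eigenmatrix of each compression [F A C] to be
invertible, so the compression is scalar. If the rank were at least two, an
off-diagonal entry of [F A C] would vanish for all [A], against transitivity. *)
Lemma exists_rank1 (R : realType) n (S : set 'M[R[i]]_n.+1) :
  mx_semigroup S -> irreducible S ->
  (forall A, with_one S A -> 0 <= \tr A) ->
  exists (u : 'cV[R[i]]_n.+1) (v : 'rV[R[i]]_n.+1),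
    [/\ u != 0, v != 0 & bidual_cone (with_one S) (u *m v)].
Proof.
move=> Smul Sirr Str; have S1mon := with_one_monoid Smul.
have [S11 S1mul] := S1mon; set T := bidual_cone (with_one S).
have Ttr X : T X -> 0 <= \tr X.
  by move=> /(_ 1%:M); rewrite mul1mx; apply=> A /Str; rewrite mul1mx.
pose P m := `[< exists2 L, T L & \rank L = m.+1 >].
have exP : exists m, P m.
  exists n; apply/asboolP; exists 1%:M; last exact: mxrank1.
  exact: bidual_cone_gen.
have [m /asboolP[L TL rL] mmin] := ex_minnP exP.
have {}mmin X : T X -> X != 0 -> (m < \rank X)%N.
  move=> TX; rewrite -mxrank_eq0 -lt0n; case E: (\rank X) => [//|k] _.
  by rewrite ltnS; apply: mmin; apply/asboolP; exists X.
have [C [F [LE Cfree Ffree]]] : exists (C : 'M_(n.+1, m.+1)) (F : 'M_(m.+1, n.+1)),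
    [/\ L = C *m F, row_free C^T & row_free F].
  rewrite -rL; exists (col_base L), (row_base L).
  rewrite mulmx_base row_base_free /row_free mxrank_tr; split=> //.
  exact: col_base_full.
have C0 k (Z : 'M_(m.+1, k)) : C *m Z = 0 -> Z = 0.
  move=> /(congr1 trmx); rewrite trmx_mul trmx0 => /eqP.
  by rewrite mulmx_free_eq0// => /eqP /(congr1 trmx); rewrite trmxK trmx0.
(* Placed between [C] and [F], the powers of [Y] become products of copies of [L]
and [X], hence elements of [T]; the same then holds for every matrix in the bidual
cone of these powers, in particular for the Perron eigenmatrix [L'] of [Y]. *)
have scal X : with_one S X -> exists c, F *m X *m C = c%:M.
  move=> SX; have TX : T X by apply: bidual_cone_gen.
  pose Y := F *m X *m C; pose G : set 'M_m.+1 := fun Z => exists k, Z = Y ^+ k.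
  have Gmon : mx_monoid G.
    split; first by exists 0.
    by move=> _ _ [j ->] [k ->]; exists (j + k)%N; rewrite exprD.
  have TY k : T (C *m Y ^+ k *m F).
    elim: k => [|k IH]; first by rewrite expr0 mulmx1 -LE.
    have -> : C *m Y ^+ k.+1 *m F = (C *m Y ^+ k *m F) *m (X *m L).
      by rewrite exprSr LE -mulmxE /Y !mulmxA.
    by do 2![apply: bidual_coneM => //].
  have Gtr A : G A -> 0 <= \tr A.
    move=> [[|k] ->]; first by rewrite expr0 mxtrace1 ler0n.
    have -> : \tr (Y ^+ k.+1) = \tr (X *m (C *m Y ^+ k *m F)).
      rewrite exprS -mulmxE; move: (Y ^+ k) => Z; rewrite /Y -!mulmxA.
      by rewrite mxtrace_mulC !mulmxA.
    exact: Ttr (bidual_coneM S1mul TX (TY k)).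
  have GY : bidual_cone G Y by apply: bidual_cone_gen; exists 1.
  have [r [L' [GL' L'0 YL' _]]] := cone_eigen Gmon Gtr GY.
  have TL' : T (C *m L' *m F).
    by apply: bidual_cone_trans GL' => _ [k ->]; exact: TY.
  have CL'F0 : C *m L' *m F != 0.
    apply: contra L'0; rewrite mulmx_free_eq0// => /eqP/C0 ->; exact: eqxx.
  have uL' : L' \in unitmx.
    rewrite -row_free_unit -row_leq_rank (leq_trans (mmin _ TL' CL'F0))//.
    by rewrite (leq_trans (mxrankM_maxl _ _))// mxrankM_maxr.
  exists r%:C; rewrite -/Y -[Y](mulmxK uL') YL' -scalemxAl mulmxV//.
  by rewrite scalemx1.
case: m => [|m] in mmin C F rL LE Cfree Ffree C0 scal *.
  have L0 : L != 0 by rewrite -mxrank_eq0 rL.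
  exists C, F; rewrite -LE; split=> //.
    by apply: contra L0 => /eqP C00; rewrite LE C00 mul0mx.
  by apply: contra L0 => /eqP F0; rewrite LE F0 mulmx0.
have x0 : col 0 C != 0.
  rewrite colE; apply/eqP => /C0 /matrixP/(_ 0 0); rewrite !mxE /=.
  by move/eqP; rewrite oner_eq0.
have y0 : row (lift 0 0) F != 0.
  rewrite rowE mulmx_free_eq0//; apply/eqP => /matrixP/(_ 0 (lift 0 0)).
  by rewrite !mxE !eqxx => /eqP; rewrite oner_eq0.
have [A SA] := irreducible_transitive Smul Sirr x0 y0.
have [c cE] := scal A SA.
rewrite rowE colE mulmxA -(mulmxA _ F A) -(mulmxA _ _ C) cE -rowE -colE.
by rewrite !mxE eqxx.
Qed.

(** * Separating families of nonnegative vectors *)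

Definition nneg (R : realType) m n (A : 'M[R[i]]_(m, n)) : Prop :=
  forall i j, 0 <= A i j.

(** For a family of vectors this says that it spans the whole space. *)
Definition separates_rows (R : realType) n (U : set 'cV[R[i]]_n) : Prop :=
  forall y : 'rV_n, y != 0 -> exists2 u, U u & (y *m u) 0 0 != 0.

Definition separates_cols (R : realType) n (V : set 'rV[R[i]]_n) : Prop :=
  forall x : 'cV_n, x != 0 -> exists2 v, V v & (v *m x) 0 0 != 0.

Lemma nneg_mul (R : realType) m n p (A : 'M[R[i]]_(m, n)) (B : 'M_(n, p)) :
  nneg A -> nneg B -> nneg (A *m B).
Proof.
by move=> A0 B0 i j; rewrite mxE sumr_ge0// => k _; rewrite mulr_ge0.
Qed.

(** Choose [u] and [v] with [a = y u] and [b = v x] nonzero. Then [a x] and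
[b y] are nonnegative, and so is [a b = v (x y u)]; hence [a b > 0], and
[a b x y = (a x) (b y)] is nonnegative. *)
Lemma rank1_nneg (R : realType) n (x : 'cV[R[i]]_n) (y : 'rV[R[i]]_n)
    (U : set 'cV[R[i]]_n) (V : set 'rV[R[i]]_n) :
  separates_rows U -> separates_cols V -> (forall v, V v -> nneg v) ->
  (forall u, U u -> nneg (x *m y *m u)) ->
  (forall v, V v -> nneg (v *m (x *m y))) -> nneg (x *m y).
Proof.
move=> sU sV V0 Uxy Vxy; have [->|y0] := eqVneq y 0.
  by move=> i j; rewrite mulmx0 mxE.
have [->|x0] := eqVneq x 0; first by move=> i j; rewrite mul0mx mxE.
have [u Uu yu0] := sU y y0; have [v Vv vx0] := sV x x0.
pose a := (y *m u) 0 0; pose b := (v *m x) 0 0.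
have ax i : 0 <= x i 0 * a.
  by have := Uxy u Uu i 0; rewrite -mulmxA mxE big_ord1.
have yb j : 0 <= b * y 0 j.
  by have := Vxy v Vv 0 j; rewrite mulmxA mxE big_ord1.
have ba : 0 < b * a.
  rewrite lt_def mulf_neq0//=.
  have := nneg_mul (V0 v Vv) (Uxy u Uu) 0 0.
  by rewrite -[x *m y *m u]mulmxA mulmxA mxE big_ord1.
move=> i j; rewrite mxE big_ord1 -(pmulr_rge0 _ ba).
by rewrite [b * a]mulrC mulrACA [a * _]mulrC mulr_ge0.
Qed.

(** * Nonnegative eigenvectors and closed index sets *)

(** The sets of coordinates whose coordinate subspace is invariant under [A]. *)
Definition closed_set (R : realType) n (A : 'M[R[i]]_n) (Z : {set 'I_n}) :=
  forall i k, k \in Z -> A i k != 0 -> i \in Z.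

(** With [I] the full set this is irreducibility of the zero pattern; a proper
[I] allows in addition a block triangular pattern with irreducible diagonal
blocks that are linked by a nonzero off-diagonal block. *)
Definition only_closed_set (R : realType) n (A : 'M[R[i]]_n) (I : {set 'I_n}) :=
  forall Z, closed_set A Z -> [\/ Z = finset.set0, Z = I | Z = [set: 'I_n]].

Definition supp (R : realType) n (f : 'I_n -> R[i]) := [set i | f i != 0].

Lemma sum_eq0_supp (R : realType) n (f : 'I_n -> R[i]) i :
  (forall k, 0 <= f k) -> \sum_k f k = 0 -> f i = 0.
Proof.
by move=> f0 /eqP; rewrite psumr_eq0// => /allP/(_ i (mem_index_enum _))/eqP.
Qed.

(** Where the eigenvector vanishes, a sum of nonnegative terms vanishes. *)
Lemma closed_supp_col (R : realType) n (N : 'M[R[i]]_n) (x : 'cV_n) r :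
  nneg N -> nneg x -> N *m x = r *: x -> closed_set N (supp (x^~ 0)).
Proof.
move=> N0 x0 Nx i k; rewrite !inE => xk Nik; apply: contraTN isT => /eqP xi.
have /matrixP/(_ i 0) := Nx; rewrite !mxE xi mulr0.
move/(sum_eq0_supp k (fun k => mulr_ge0 (N0 i k) (x0 k 0)))/eqP.
by rewrite mulf_eq0 (negPf xk) (negPf Nik).
Qed.

Lemma closed_supp_row (R : realType) n (N : 'M[R[i]]_n) (y : 'rV_n) r :
  nneg N -> nneg y -> y *m N = r *: y -> closed_set N (~: supp (y 0)).
Proof.
move=> N0 y0 yN i k; rewrite !inE !negbK => /eqP yk Nik.
have /matrixP/(_ 0 k) := yN; rewrite !mxE yk mulr0.
move/(sum_eq0_supp i (fun i => mulr_ge0 (y0 0 i) (N0 i k)))/eqP.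
by rewrite mulf_eq0 (negPf Nik) orbF.
Qed.

(** Subtract the largest multiple of [y] that keeps the difference nonnegative:
[c] is the least ratio of coordinates over the support of [y]. *)
Lemma subtract_eigenvector (R : realType) n (N : 'M[R[i]]_n) (x y : 'cV_n) r :
  nneg x -> nneg y -> y != 0 -> N *m x = r *: x -> N *m y = r *: y ->
  exists c (z : 'cV_n), [/\ x = c *: y + z, nneg z, N *m z = r *: z &
    exists2 i, y i 0 != 0 & z i 0 = 0].
Proof.
move=> x0 y0 ynz Nx Ny.
have [i0 yi0] : exists i0, y i0 0 != 0.
  by move/matrix0Pn: ynz => [i [j]]; rewrite ord1; exists i.
have [i yi imin] := @arg_minP _ _ _ i0 (fun i => y i 0 != 0)
  (fun i => Re (x i 0 / y i 0)) yi0.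
have Imq j : Im (x j 0 / y j 0) = 0.
  have : 0 <= x j 0 / y j 0 by rewrite divr_ge0.
  by rewrite lecE => /andP[/eqP->].
exists (x i 0 / y i 0), (x - (x i 0 / y i 0) *: y).
rewrite subrKC; split=> //.
- move=> j k; rewrite ord1 !mxE subr_ge0.
  have [->|yj] := eqVneq (y j 0) 0; first by rewrite mulr0.
  have yj0 : 0 < y j 0 by rewrite lt_def yj y0.
  by rewrite -ler_pdivlMr// lecE !Imq eqxx imin.
- by rewrite mulmxBr -scalemxAr Nx Ny scalerBr !scalerA mulrC.
by exists i => //; rewrite !mxE divfK// subrr.
Qed.

Lemma supp_eq0 (R : realType) n (x : 'cV[R[i]]_n) :
  supp (x^~ 0) = finset.set0 -> x = 0.
Proof.
move=> sx; apply/matrixP => i j; rewrite ord1 mxE; apply/eqP.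
by have := finset.in_set0 i; rewrite -sx inE => /negbFE.
Qed.

(** Supports of nonnegative eigenvectors are closed. Subtracting a multiple of
[y] from [x] leaves a remainder [z] with a zero in the support of [y], so [z] is
zero or has support [I]; in the latter case subtracting a multiple of [z] from
[y] in turn leaves no remainder. *)
Lemma nneg_eigenvector_unique (R : realType) n (N : 'M[R[i]]_n) I (x y : 'cV_n) r :
  nneg N -> only_closed_set N I -> nneg x -> nneg y -> y != 0 ->
  N *m x = r *: x -> N *m y = r *: y -> exists c, x = c *: y.
Proof.
move=> N0 NI.
have suppI (v w : 'cV_n) : nneg v -> nneg w -> w != 0 -> N *m v = r *: v ->
    N *m w = r *: w -> supp (w^~ 0) = I -> exists c, v = c *: w.
  move=> v0 w0 wnz Nv Nw wI.
  have [c [z [vE z0 Nz [i wi zi]]]] := subtract_eigenvector v0 w0 wnz Nv Nw.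
  exists c; rewrite vE; suff -> : z = 0 by rewrite addr0.
  have [/supp_eq0//|zI|zT] := NI _ (closed_supp_col N0 z0 Nz).
    have : i \in supp (w^~ 0) by rewrite inE.
    by rewrite wI -zI inE zi eqxx.
  by have := finset.in_setT i; rewrite -zT inE zi eqxx.
move=> x0 y0 ynz Nx Ny.
have [c [z [xE z0 Nz [i yi zi]]]] := subtract_eigenvector x0 y0 ynz Nx Ny.
have [/supp_eq0 zz|zI|zT] := NI _ (closed_supp_col N0 z0 Nz).
- by exists c; rewrite xE zz addr0.
- have [zz|znz] := eqVneq z 0; first by exists c; rewrite xE zz addr0.
  have [c' yE] := suppI y z y0 z0 znz Ny Nz zI.
  have c'0 : c' != 0 by apply: contraNneq ynz => c'0; rewrite yE c'0 scale0r.
  exists (c + c'^-1).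
  by rewrite xE scalerDl; congr (_ + _); rewrite yE scalerA mulVf// scale1r.
by have := finset.in_setT i; rewrite -zT inE zi eqxx.
Qed.

(** All columns of [L] are nonnegative eigenvectors, hence proportional. As
the support of [x] is closed and that of [y] has closed complement, the first is
[I] or everything, the second the complement of [I] or everything. *)
Lemma nneg_eigenmatrix_rank1 (R : realType) n (N L : 'M[R[i]]_n) I r :
  nneg N -> only_closed_set N I -> nneg L -> L != 0 ->
  N *m L = r *: L -> L *m N = r *: L ->
  exists (x : 'cV_n) (y : 'rV_n), [/\ L = x *m y, nneg x, nneg y &
    forall i, (x i 0 != 0) || (y 0 i != 0)].
Proof.
move=> N0 NI L0 Lnz NL LN; have /matrix0Pn[i0 [j0 Lij]] := Lnz.
pose x := col j0 L.
have Lcol j : N *m col j L = r *: col j L.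
  by rewrite !colE mulmxA NL scalemxAl.
have colL0 j : nneg (col j L) by move=> i k; rewrite mxE.
have xnz : x != 0.
  by apply: contraNneq Lij => /matrixP/(_ i0 0); rewrite !mxE => ->.
have [c cE] := fin_all_exists (fun j =>
  nneg_eigenvector_unique N0 NI (colL0 j) (colL0 j0) xnz (Lcol j) (Lcol j0)).
pose y := \row_j c j.
have LE : L = x *m y.
  apply/matrixP => i j; have /matrixP/(_ i 0) := cE j.
  by rewrite !mxE big_ord1 !mxE mulrC.
have xi0 : 0 < x i0 0 by rewrite lt_def mxE Lij L0.
have y0 : nneg y.
  move=> k j; rewrite ord1 -(pmulr_rge0 _ xi0).
  by have := L0 i0 j; rewrite LE mxE big_ord1.
have ynz : y != 0 by apply: contraNneq Lnz => yz; rewrite LE yz mulmx0.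
have yN : y *m N = r *: y.
  apply/rowP => j; apply: (mulfI (lt0r_neq0 xi0)).
  have /matrixP/(_ i0 j) := LN; rewrite LE -mulmxA scalemxAr.
  by rewrite [in X in X = _ -> _]mxE [in X in _ = X -> _]mxE !big_ord1.
exists x, y; split=> //; first exact: colL0.
move=> i; have [xs|xI|xT] := NI _ (closed_supp_col N0 (colL0 j0) (Lcol j0)).
- by move/supp_eq0: xs => xz; rewrite /x xz eqxx in xnz.
- have [yT|yI|ys] := NI _ (closed_supp_row N0 y0 yN).
  + by have := finset.in_set0 i; rewrite -yT !inE => /negbFE->; rewrite orbT.
  + case iI : (i \in I); first by move: iI; rewrite -xI inE => ->.
    by move: iI; rewrite -yI !inE => /negbFE->; rewrite orbT.
  case/eqP: ynz; apply/rowP => j; rewrite [RHS]mxE; apply/eqP.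
  by have := finset.in_setT j; rewrite -ys !inE negbK.
by have := finset.in_setT i; rewrite -xT inE => ->.
Qed.

(** * Diagonal matrices *)

Definition diag_of (R : realType) n (d : 'I_n -> R[i]) : 'M[R[i]]_n :=
  diag_mx (\row_i d i).

Lemma diag_of_conjE (R : realType) n (d : 'I_n -> R[i]) (A : 'M_n) i j :
  (diag_of d *m A *m diag_of (fun k => (d k)^-1)) i j = d i * A i j / d j.
Proof. by rewrite mul_mx_diag mxE mul_diag_mx !mxE. Qed.

Lemma diag_ofV (R : realType) n (d : 'I_n -> R[i]) :
  (forall i, d i != 0) -> diag_of d *m diag_of (fun k => (d k)^-1) = 1%:M.
Proof.
move=> d0; rewrite mulmx_diag -diag_const_mx; congr diag_mx.
by apply/rowP => i; rewrite !mxE divff.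
Qed.

Lemma diag_ofVl (R : realType) n (d : 'I_n -> R[i]) :
  (forall i, d i != 0) -> diag_of (fun k => (d k)^-1) *m diag_of d = 1%:M.
Proof. by move=> d0; apply/mulmx1C/diag_ofV. Qed.

Lemma inv_diag_mx_diag_of (R : realType) n (d : 'I_n -> R[i]) :
  (forall i, d i != 0) ->
  inv_diag_mx (diag_of d) /\ invmx (diag_of d) = diag_of (fun i => (d i)^-1).
Proof.
move=> d0; have DD' := diag_ofV d0; have [uD _] := mulmx1_unit DD'.
split; last by rewrite -[LHS]mulmx1 -DD' mulKmx.
by split=> //; apply: diag_mx_is_diag.
Qed.

(** * From local to simultaneous nonnegativity *)

(** The role of [U] and [V] will be played by the normalised columns [X u] and
rows [v X], where [u v] is a fixed rank-one element of the cone and [X] runs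
through the semigroup with identity. *)
Definition positive_frames (R : realType) n (S : 'M[R[i]]_n)
    (U : set 'cV_n) (V : set 'rV_n) : Prop :=
  [/\ separates_rows U, separates_cols V,
      forall u, U u -> nneg u /\ U (S *m u) &
      forall v, V v -> nneg v /\ V (v *m S)].

Definition locally_nneg (R : realType) n (S : 'M[R[i]]_n) : Prop :=
  exists2 d, forall i, d i != 0 & forall i j, 0 <= d i * S i j / d j.

(** With [N = D S D^-1] nonnegative, the Perron eigenmatrix [L] of [S] and its
conjugate [M = D L D^-1] are both nonnegative: [M] since it lies in the bidual
cone of the powers of [N], and [L] since [M], hence [L], has rank one and [L] maps
[U] and [V] to nonnegative vectors. So [d j / d i] is positive whenever
[M i j != 0]. As [M = x y] and the supports of [x] and [y] cover all indices,
all ratios of entries of [d] are positive, and then [S] is nonnegative together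
with [N]. *)
Lemma nneg_of_local (R : realType) n (S : 'M[R[i]]_n) I U V :
  locally_nneg S -> only_closed_set S I -> positive_frames S U V -> nneg S.
Proof.
case: n S I U V => [|n] S I U V; first by move=> _ _ _ [].
move=> [d d0 dS] SI [sU sV Upos Vpos].
have US k u : U u -> nneg (S ^+ k *m u).
  elim: k u => [|k IH] u Uu; first by rewrite expr0 mul1mx; case: (Upos u Uu).
  by rewrite exprSr -mulmxE -mulmxA; apply: IH; case: (Upos u Uu).
have VS k v : V v -> nneg (v *m S ^+ k).
  elim: k v => [|k IH] v Vv; first by rewrite expr0 mulmx1; case: (Vpos v Vv).
  by rewrite exprS -mulmxE mulmxA; apply: IH; case: (Vpos v Vv).
pose D := diag_of d; pose D' := diag_of (fun k => (d k)^-1).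
have DD' : D *m D' = 1%:M by apply: diag_ofV.
have D'D : D' *m D = 1%:M by apply: diag_ofVl.
pose N := D *m S *m D'.
have N0 : nneg N by move=> i j; rewrite diag_of_conjE.
have NX k : D *m S ^+ k *m D' = N ^+ k.
  elim: k => [|k IH]; first by rewrite !expr0 mulmx1.
  rewrite !exprS -IH -!mulmxE /N -!mulmxA; congr (_ *m (_ *m _)).
  by rewrite (mulmxA D') D'D mul1mx.
have NX0 k : nneg (N ^+ k).
  elim: k => [|k IH]; last by rewrite exprS; apply: nneg_mul.
  by move=> i j; rewrite expr0 mxE ler0n.
pose G : set 'M_n.+1 := fun A => exists k, A = S ^+ k.
have Gmon : mx_monoid G.
  split; first by exists 0.
  by move=> _ _ [j ->] [k ->]; exists (j + k)%N; rewrite exprD.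
have Gtr A : G A -> 0 <= \tr A.
  move=> [k ->]; rewrite -[S ^+ k]mulmx1 -D'D mulmxA mxtrace_mulC mulmxA NX.
  by apply: sumr_ge0 => i _; apply: NX0.
have GS : bidual_cone G S by apply: bidual_cone_gen; exists 1.
have [r [L [GL Lnz SL LS]]] := cone_eigen Gmon Gtr GS.
pose M := D *m L *m D'.
have LE : L = D' *m M *m D.
  by rewrite /M !mulmxA D'D mul1mx -mulmxA D'D mulmx1.
have M0 : nneg M.
  by move=> i j; apply: bidual_cone_entry GL => _ [k ->]; rewrite NX; apply: NX0.
have Mnz : M != 0.
  by apply: contraNneq Lnz => Mz; rewrite LE Mz mulmx0 mul0mx.
have NM : N *m M = r%:C *: M.
  rewrite /N /M -!mulmxA (mulmxA D') D'D mul1mx (mulmxA S) SL.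
  by rewrite -!scalemxAl -!scalemxAr.
have MN : M *m N = r%:C *: M.
  rewrite /N /M -!mulmxA (mulmxA D') D'D mul1mx (mulmxA L) LS.
  by rewrite -!scalemxAl -!scalemxAr.
have NI : only_closed_set N I.
  move=> Z Zc; apply: SI => i k kZ Sik; apply: Zc kZ _.
  by rewrite diag_of_conjE !mulf_neq0 ?invr_eq0.
have [x [y [ME x0 y0 xy]]] := nneg_eigenmatrix_rank1 N0 NI M0 Mnz NM MN.
have L0 : nneg L.
  have LE' : L = (D' *m x) *m (y *m D) by rewrite LE ME !mulmxA.
  rewrite LE'; apply: rank1_nneg sU sV _ _ _.
  - by move=> v /(VS 0%N); rewrite expr0 mulmx1.
  - move=> u Uu i j; rewrite -LE' -[L]mulmx1 -(mulmxA L) mul1mx -[L]mul1mx.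
    by apply: bidual_cone_entry GL => _ [k ->]; rewrite mul1mx; apply: US.
  - move=> v Vv i j; rewrite -LE' -[_ *m L]mulmx1.
    by apply: bidual_cone_entry GL => _ [k ->]; rewrite mulmx1; apply: VS.
have /matrix0Pn[i0 [j0]] := Mnz; rewrite ME mxE big_ord1 mulf_eq0 negb_or.
move=> /andP[xi0 yj0].
have xi_gt0 i : x i 0 != 0 -> 0 < x i 0 by move=> xi; rewrite lt_def xi x0.
have yj_gt0 j : y 0 j != 0 -> 0 < y 0 j by move=> yj; rewrite lt_def yj y0.
have ratio i j : x i 0 != 0 -> y 0 j != 0 -> 0 < d j / d i.
  move=> xi yj; have Mij : 0 < M i j.
    by rewrite ME mxE big_ord1 mulr_gt0 ?xi_gt0 ?yj_gt0.

  have ML : M i j = d i * L i j / d j by rewrite diag_of_conjE.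
  have Lij : L i j != 0.
    by apply: contraTneq Mij => Lz; rewrite ML Lz mulr0 mul0r ltxx.
  have -> : d j / d i = L i j / M i j by rewrite ML; field; rewrite !d0 Lij.
  by rewrite divr_gt0// lt_def Lij L0.
have pos i : 0 < d j0 / d i.
  have [xi|] := boolP (x i 0 != 0); first exact: ratio.
  move=> xi; have yi : y 0 i != 0 by have := xy i; rewrite (negPf xi).
  have -> : d j0 / d i = (d j0 / d i0) / (d i / d i0) by field; rewrite !d0.
  by rewrite divr_gt0 ?ratio.
move=> i j.
have -> : S i j = (d j0 / d i) / (d j0 / d j) * (d i * S i j / d j).
  by field; rewrite !d0.
by apply: mulr_ge0 => //; apply: divr_ge0; exact: ltW.
Qed.

Lemma invmx_perm (R : realType) n (s : 'S_n) :
  invmx (perm_mx s) = perm_mx s^-1 :> 'M[R[i]]_n.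
Proof.
rewrite -[LHS]mulmx1 -(perm_mx1 _ n) -(mulgV s) perm_mxM mulKmx//.
exact: unitmx_perm.
Qed.

(** A nontrivial closed set [Z] yields a block triangular form: list the indices
in [Z] first. *)
Lemma only_closed_set_indecomposable (R : realType) n (A : 'M[R[i]]_n) :
  n = 1%N \/ indecomposable_mx A -> only_closed_set A [set: 'I_n].
Proof.
move=> [n1|Aind] Z Zc.
  subst n; have [->|/set0Pn[i iZ]] := eqVneq Z finset.set0; first by constructor 1.
  by constructor 2; apply/setP => j; rewrite inE -iZ !ord1.
have [->|Z0] := eqVneq Z finset.set0; first by constructor 1.
have [->|ZT] := eqVneq Z [set: 'I_n]; first by constructor 2.
case: Aind; pose e := enum Z ++ enum (~: Z).
have kmn : (#|Z| + #|~: Z|)%N = n by rewrite cardsC card_ord.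
have e_size : size e = n by rewrite size_cat -!cardE.
have e_uniq : uniq e.
  rewrite cat_uniq !enum_uniq andbT /=; apply/hasPn => i.
  by rewrite !mem_enum inE.
have f_inj : injective (fun i : 'I_n => nth i e i).
  move=> i j /=; rewrite (set_nth_default i j) ?e_size// => /eqP.
  by rewrite nth_uniq ?e_size// => /eqP/val_inj.
pose s := perm f_inj.
have sZ (i : 'I_n) : (s i \in Z) = (i < #|Z|)%N.
  rewrite permE nth_cat -cardE; case: ltnP => iZ.
    by rewrite -mem_enum mem_nth// -cardE.
  apply/negbTE; rewrite -finset.in_setC -mem_enum mem_nth// -cardE.
  by rewrite ltn_subLR// kmn.
exists #|Z|, #|~: Z|, kmn, s; split.
- by rewrite card_gt0.
- rewrite card_gt0; apply: contra ZT => /eqP ZC.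
  by rewrite -[Z]finset.setCK ZC finset.setC0.
move=> _ ->; set M := _ *m _ *m _.
have ME i j : M i j = A (s i) (s j).
  by rewrite /M invmx_perm -row_permE -col_permE !mxE.
pose M' := castmx (esym kmn, esym kmn) M.
exists (ulsubmx M'), (ursubmx M'), (drsubmx M').
rewrite -[LHS](castmxKV kmn kmn) -/M' -[M' in LHS]submxK.
congr (castmx _ (block_mx _ _ _ _)).
apply/matrixP => i j; rewrite !mxE castmxE ME; apply: contraTeq isT => Aij.
have := Zc _ _ _ Aij; rewrite !sZ /= ltn_ord => /(_ isT).
by rewrite ltnNge leq_addr.
Qed.

(** Serves both for reordering the indices and for cutting out a diagonal block
when the off-diagonal block is zero. *)
Lemma positive_frames_compress (R : realType) n p (S : 'M[R[i]]_n) (S' : 'M_p)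
    (P : 'M_(p, n)) (Q : 'M_(n, p)) U V :
  nneg P -> nneg Q -> P *m Q = 1%:M -> P *m S = S' *m P -> S *m Q = Q *m S' ->
  positive_frames S U V ->
  positive_frames S' [set P *m u | u in U]%classic [set v *m Q | v in V]%classic.
Proof.
move=> P0 Q0 PQ PS SQ [sU sV Upos Vpos]; split.
- move=> y y0; have yP0 : y *m P != 0.
    by apply: contraNneq y0 => yP; rewrite -[y]mulmx1 -PQ mulmxA yP mul0mx.
  by have [u Uu yPu] := sU _ yP0; exists (P *m u); [exists u|rewrite mulmxA].
- move=> x x0; have Qx0 : Q *m x != 0.
    by apply: contraNneq x0 => Qx; rewrite -[x]mul1mx -PQ -mulmxA Qx mulmx0.
  by have [v Vv vQx] := sV _ Qx0; exists (v *m Q); [exists v|rewrite -mulmxA].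
- move=> _ [u Uu <-]; have [u0 USu] := Upos u Uu.
  by split; [exact: nneg_mul|exists (S *m u) => //; rewrite !mulmxA PS].
move=> _ [v Vv <-]; have [v0 VvS] := Vpos v Vv.
by split; [exact: nneg_mul|exists (v *m S) => //; rewrite -!mulmxA SQ].
Qed.

(** If [B] has a nonzero entry, it links the two irreducible blocks, and the
only nontrivial closed set is the first block. If [B] is zero, each diagonal
block inherits the frames and is irreducible on its own. *)
Lemma nneg_block_of_local (R : realType) k m (A1 : 'M[R[i]]_k) (B : 'M_(k, m))
    (A2 : 'M_m) U V :
  only_closed_set A1 [set: 'I_k] -> only_closed_set A2 [set: 'I_m] ->
  locally_nneg (block_mx A1 B 0 A2) ->
  positive_frames (block_mx A1 B 0 A2) U V -> nneg (block_mx A1 B 0 A2).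
Proof.
move=> A1c A2c locS frS; set S := block_mx A1 B 0 A2 in locS frS *.
have [B0|/matrix0Pn[i0 [j0 Bij]]] := eqVneq B 0; last first.
  refine (nneg_of_local (I := [set i : 'I_(k + m) | (i < k)%N]) locS _ frS) => Z Zc.
  have Z1 : closed_set A1 [set i | lshift m i \in Z].
    move=> i j; rewrite !inE => jZ Aij; apply: Zc jZ _.
    by rewrite block_mxEul.
  have Z2 : closed_set A2 [set i | rshift k i \in Z].
    move=> i j; rewrite !inE => jZ Aij; apply: Zc jZ _.
    by rewrite block_mxEdr.
  have Z1E : [set i | lshift m i \in Z] = finset.set0
      \/ [set i | lshift m i \in Z] = [set: 'I_k] by case: (A1c _ Z1); auto.
  have [Z20|Z2T] : [set i | rshift k i \in Z] = finset.set0
      \/ [set i | rshift k i \in Z] = [set: 'I_m] by case: (A2c _ Z2); auto.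
    have {}Z20 i : (rshift k i \in Z) = false.
      by have := finset.in_set0 i; rewrite -Z20 inE.
    case: Z1E => Z1E; [constructor 1|constructor 2]; apply/setP => i.
      have Z10 j : (lshift m j \in Z) = false.
        by have := finset.in_set0 j; rewrite -Z1E inE.
      by rewrite inE; case: (split_ordP i) => j ->; rewrite ?Z20 ?Z10.
    have Z1T j : lshift m j \in Z.
      by have := finset.in_setT j; rewrite -Z1E inE.
    rewrite inE; case: (split_ordP i) => j ->; first by rewrite Z1T.
    by rewrite Z20.
  have {}Z2T i : rshift k i \in Z.
    by have := finset.in_setT i; rewrite -Z2T inE.
  have i0Z : lshift m i0 \in Z.
    by apply: (Zc _ (rshift k j0)); rewrite ?Z2T// block_mxEur.
  case: Z1E => Z1E.
    by have := finset.in_set0 i0; rewrite -Z1E inE i0Z.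
  constructor 3; apply/setP => i; rewrite [RHS]inE.
  case: (split_ordP i) => j ->; last exact: Z2T.
  by have := finset.in_setT j; rewrite -Z1E inE.
have [d d0 dS] := locS.
have id_nneg p : nneg (1%:M : 'M[R[i]]_p) by move=> i j; rewrite mxE ler0n.
have A1_0 : nneg A1.
  apply: (@nneg_of_local _ _ _ [set: 'I_k]) => //.
    exists (fun i => d (lshift m i)) => // i j.
    by have := dS (lshift m i) (lshift m j); rewrite block_mxEul.
  apply: (@positive_frames_compress _ _ _ _ _ (row_mx 1%:M 0) (col_mx 1%:M 0)) frS.
  - by move=> i j; rewrite mxE; case: split => ?; rewrite ?id_nneg// mxE.
  - by move=> i j; rewrite mxE; case: split => ?; rewrite ?id_nneg// mxE.
  - by rewrite mul_row_col mulmx1 mulmx0 addr0.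
  - by rewrite /S B0 mul_row_block mul_mx_row !mul1mx !mul0mx mulmx1 mulmx0 !addr0.
  by rewrite /S B0 mul_block_col mul_col_mx !mulmx1 !mulmx0 mul1mx mul0mx !addr0.
have A2_0 : nneg A2.
  apply: (@nneg_of_local _ _ _ [set: 'I_m]) => //.
    exists (fun i => d (rshift k i)) => // i j.
    by have := dS (rshift k i) (rshift k j); rewrite block_mxEdr.
  apply: (@positive_frames_compress _ _ _ _ _ (row_mx 0 1%:M) (col_mx 0 1%:M)) frS.
  - by move=> i j; rewrite mxE; case: split => ?; rewrite ?id_nneg// mxE.
  - by move=> i j; rewrite mxE; case: split => ?; rewrite ?id_nneg// mxE.
  - by rewrite mul_row_col mulmx1 mulmx0 add0r.
  - by rewrite /S B0 mul_row_block mul_mx_row !mul1mx !mul0mx mulmx1 mulmx0 !add0r.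
  by rewrite /S B0 mul_block_col mul_col_mx !mulmx1 !mulmx0 mul1mx mul0mx !add0r.
move=> i j; rewrite /S B0.
case: (split_ordP i) => i' ->; case: (split_ordP j) => j' ->.
- by rewrite block_mxEul.
- by rewrite block_mxEur mxE.
- by rewrite block_mxEdl mxE.
by rewrite block_mxEdr.
Qed.

(** Diagonal similarity keeps the zero pattern, so that decomposability
properties can be read off before the similarity. *)
Definition same_pattern (R : realType) n (A B : 'M[R[i]]_n) : Prop :=
  forall i j, (A i j == 0) = (B i j == 0).

Lemma only_closed_set_pattern (R : realType) n (A B : 'M[R[i]]_n) I :
  same_pattern A B -> only_closed_set A I -> only_closed_set B I.
Proof.
by move=> AB AI Z Zc; apply: AI => i k kZ; rewrite AB; apply: Zc.
Qed.

Lemma nneg_of_one_decomposable (R : realType) n (A S : 'M[R[i]]_n) U V :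
  one_decomposable A -> same_pattern A S -> locally_nneg S ->
  positive_frames S U V -> nneg S.
Proof.
move=> [k [m [kmn [s [A1 [B [A2 [k0 m0 AE A1ind A2ind]]]]]]]].
case: n / kmn A S s U V AE => A S s U V; rewrite castmx_id => AE AS [d d0 dS] frS.
pose P : 'M[R[i]]_(k + m) := perm_mx s; pose S' := P *m S *m P^T.
have conjE (X : 'M_(k + m)) i j : (P *m X *m P^T) i j = X (s i) (s j).
  by rewrite /P tr_perm_mx -row_permE -col_permE !mxE.
have PPT : P *m P^T = 1%:M.
  by rewrite /P tr_perm_mx -perm_mxM mulgV perm_mx1.
have PTP : P^T *m P = 1%:M by apply: mulmx1C.
have S'E : same_pattern (block_mx A1 B 0 A2) S'.
  by move=> i j; rewrite -AE !conjE AS.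
have frS' : positive_frames S' [set P *m u | u in U]%classic
    [set v *m P^T | v in V]%classic.
  apply: positive_frames_compress frS => //.
  - by move=> i j; rewrite !mxE ler0n.
  - by move=> i j; rewrite !mxE ler0n.
  - by rewrite /S' -!mulmxA PTP mulmx1.
  by rewrite /S' !mulmxA PTP mul1mx.
have locS' : locally_nneg S'.
  by exists (fun i => d (s i)) => [i|i j]; rewrite ?d0// conjE.
have dl0 : dlsubmx S' = 0.
  apply/matrixP => i j; rewrite [LHS]mxE [LHS]mxE [RHS]mxE; apply/eqP.
  by have := S'E (rshift k i) (lshift m j); rewrite block_mxEdl mxE eqxx => <-.
have S'0 : nneg S'.
  rewrite -[S']submxK dl0 in locS' frS' *.
  apply: nneg_block_of_local locS' frS'.
    apply: only_closed_set_pattern (only_closed_set_indecomposable A1ind).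
    by move=> i j; rewrite [in RHS]mxE [in RHS]mxE -(S'E (lshift m i)) block_mxEul.
  apply: only_closed_set_pattern (only_closed_set_indecomposable A2ind).
  by move=> i j; rewrite [in RHS]mxE [in RHS]mxE -(S'E (rshift k i)) block_mxEdr.
move=> p q; rewrite -[p](permKV s) -[q](permKV s) -conjE.
exact: S'0.
Qed.

Lemma locally_nneg_diag_similar (R : realType) n (A B : 'M[R[i]]_n) :
  diag_similar A B -> nonneg_mx B -> locally_nneg A.
Proof.
move=> [D [/diag_mxP[v DE] uD] BE] B0.
have v0 i : v 0 i != 0.
  have : \prod_j v 0 j != 0 by rewrite -det_diag -DE -unitfE -unitmxE.
  by move/prodf_neq0; apply.
have DE' : D = diag_of (v 0).
  by rewrite DE; congr diag_mx; apply/rowP => i; rewrite !mxE.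
exists (v 0) => // i j; rewrite -diag_of_conjE.
by rewrite -(inv_diag_mx_diag_of v0).2 -DE' -BE.
Qed.

Lemma rank_le1_factor (R : realType) n (A : 'M[R[i]]_n) :
  (\rank A <= 1)%N -> exists (x : 'cV_n) (y : 'rV_n), A = x *m y.
Proof.
move=> rA; have := mulmx_base A; move: (col_base A) (row_base A).
case: (\rank A) rA => [|[|//]] _ C F <-; last by exists C, F.
by exists 0, 0; rewrite (flatmx0 F) !mulmx0.
Qed.

Theorem theorem3p8 (R : realType) (n : nat) (S : set 'M[R[i]]_n)
  (n_ge2 : (2 <= n)%N)
  (S_semigroup : mx_semigroup S)
  (S_irreducible : irreducible S)
  (S_diag_similar : forall A : 'M[R[i]]_n, S A ->
     exists2 B : 'M[R[i]]_n, diag_similar A B & nonneg_mx B)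
  (S_rank2 : forall A : 'M[R[i]]_n, S A -> (2 <= \rank A)%N ->
     indecomposable_mx A \/ one_decomposable A) :
  exists2 D : 'M[R[i]]_n, inv_diag_mx D &
    forall A : 'M[R[i]]_n, S A -> nonneg_mx (D *m A *m invmx D).
Proof.
case: n S n_ge2 S_semigroup S_irreducible S_diag_similar S_rank2 => // n S _.
move=> Smul Sirr Sdiag S2; have S1mon := with_one_monoid Smul.
have [S11 S1mul] := S1mon.
have Sloc A : S A -> locally_nneg A.
  by move=> /Sdiag[B AB B0]; apply: locally_nneg_diag_similar AB B0.
have S1diag A i : with_one S A -> 0 <= A i i.
  move=> [->|/Sloc[d d0 dA]]; first by rewrite mxE ler0n.
  by have := dA i i; rewrite mulrAC divff// mul1r.
have [u0 [v0 [u0nz v0nz uv]]] : exists (u : 'cV_n.+1) (v : 'rV_n.+1),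
    [/\ u != 0, v != 0 & bidual_cone (with_one S) (u *m v)].
  apply: exists_rank1 => // A SA; apply: sumr_ge0 => i _; exact: S1diag.
(* The diagonal of [A u0 v0 B], an element of the cone. *)
have uv_ge0 A B i : with_one S A -> with_one S B ->
    0 <= (A *m u0) i 0 * (v0 *m B) 0 i.
  move=> SA SB.
  have : 0 <= (A *m (u0 *m v0) *m B) i i.
    by apply: bidual_cone_entry uv => C SC; apply/S1diag/S1mul => //; apply: S1mul.
  by rewrite mulmxA -mulmxA mxE big_ord1.
have /fin_all_exists2[a Sa a0] i : exists2 A, with_one S A & (A *m u0) i 0 != 0.
  have e0 : delta_mx 0 i != 0 :> 'rV[R[i]]_n.+1.
    by apply/matrix0Pn; exists 0, i; rewrite mxE !eqxx oner_eq0.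
  have [A SA Aij] := irreducible_transitive Smul Sirr u0nz e0.
  by exists A => //; move: Aij; rewrite -mulmxA -rowE mxE.
have /fin_all_exists2[b Sb b0] i : exists2 B, with_one S B & (v0 *m B) 0 i != 0.
  have e0 : delta_mx i 0 != 0 :> 'cV[R[i]]_n.+1.
    by apply/matrix0Pn; exists i, 0; rewrite mxE !eqxx oner_eq0.
  have [A SA Aij] := irreducible_transitive Smul Sirr e0 v0nz.
  by exists A => //; move: Aij; rewrite -colE mxE.
(* Dividing coordinate [i] by [w i] makes that coordinate nonnegative in every
column [X u0]: by [uv_ge0] and [b], its nonzero values all have the phase of [w i]. *)
pose w i := (a i *m u0) i 0; pose d i := (w i)^-1.
have d0 i : d i != 0 by rewrite invr_eq0 a0.
have [Ddiag DV] := inv_diag_mx_diag_of d0.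
exists (diag_of d) => // A SA.
set D := diag_of d in Ddiag DV *; set D' := diag_of (fun i => (d i)^-1) in DV.
have DD' : D *m D' = 1%:M by apply: diag_ofV.
have D'D : D' *m D = 1%:M by apply: diag_ofVl.
rewrite DV; set A' := D *m A *m D'.
pose U := [set D *m (X *m u0) | X in with_one S]%classic.
pose V := [set v0 *m X *m D' | X in with_one S]%classic.
have frA : positive_frames A' U V.
  split.
  - move=> y y0; have yD0 : y *m D != 0.
      by apply: contraNneq y0 => yD; rewrite -[y]mulmx1 -DD' mulmxA yD mul0mx.
    have [X SX yX] := irreducible_transitive Smul Sirr u0nz yD0.
    by exists (D *m (X *m u0)); [exists X|rewrite !mulmxA in yX *].
  - move=> x x0; have Dx0 : D' *m x != 0.
      by apply: contraNneq x0 => Dx; rewrite -[x]mul1mx -DD' -mulmxA Dx mulmx0.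
    have [X SX vX] := irreducible_transitive Smul Sirr Dx0 v0nz.
    by exists (v0 *m X *m D'); [exists X|rewrite -!mulmxA in vX *].
  - move=> _ [X SX <-]; split.
      move=> i j; rewrite ord1 mul_diag_mx [leRHS]mxE [X in X * _]mxE /d.
      have -> : (w i)^-1 * (X *m u0) i 0 =
          ((X *m u0) i 0 * (v0 *m b i) 0 i) / (w i * (v0 *m b i) 0 i).
        by field; rewrite a0 b0.
      by rewrite divr_ge0// uv_ge0.
    exists (A *m X); first by apply: S1mul => //; right.
    by rewrite /A' -!mulmxA (mulmxA D') D'D mul1mx.
  move=> _ [X SX <-]; split.
    move=> i j; rewrite ord1 mul_mx_diag [leRHS]mxE [X in _ * X]mxE /d invrK.
    by rewrite mulrC uv_ge0.
  exists (X *m A); first by apply: S1mul => //; right.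
  by rewrite /A' -!mulmxA (mulmxA D') D'D mul1mx.
have AA' : same_pattern A A'.
  by move=> i j; rewrite diag_of_conjE !mulf_eq0 !invr_eq0 !(negPf (a0 _)) orbF.
have locA' : locally_nneg A'.
  have [e e0 eA] := Sloc A SA.
  exists (fun i => e i / d i) => [i|i j]; first by rewrite mulf_neq0// invr_eq0.
  rewrite diag_of_conjE (_ : _ / _ = e i * A i j / e j)//.
  by field; rewrite !d0 e0.
have [rA|rA] := leqP (\rank A) 1.
  have [x [y AE]] := rank_le1_factor rA.
  have A'E : A' = (D *m x) *m (y *m D') by rewrite /A' AE !mulmxA.
  have [sU sV Upos Vpos] := frA; rewrite A'E.
  apply: rank1_nneg sU sV _ _ _ => [v /Vpos[]//|u Uu|v Vv]; rewrite -A'E.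
    by have [_ /Upos[]] := Upos u Uu.
  by have [_ /Vpos[]] := Vpos v Vv.
have [Aind|A1dec] := S2 A SA rA; last first.
  exact: nneg_of_one_decomposable A1dec AA' locA' frA.
apply: nneg_of_local locA' _ frA.
by apply: only_closed_set_pattern AA' (only_closed_set_indecomposable _); right.
Qed.
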